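(* Consider the multi-demand auction model with item types $N=\{1,\dots,n\}$, supply vector $u$, bidders $M=\{1,\dots,m\}$, and M$^\natural$-concave valuation functions $v_b:[\mathbf 0,u]_{\mathbb Z}\to\mathbb Z$ $(b\in M)$ that are monotone nondecreasing with $v_b(\mathbf 0)=0$, and let $$L(p)=\sum_{b\in M}\max_{x\in[\mathbf 0,u]_{\mathbb Z}}\{v_b(x)-p^\top x\}+p^\top u\qquad(p\in\mathbb Z^n_+)$$ be its Lyapunov function. Let $p^*_{\min}$ be the unique minimal minimizer of $L$ over $\mathbb Z^n_+$. Run the algorithm Lyapunov Minimization on $L$ from an initial vector $p^\circ\in\mathbb Z^n_+$ with $p^\circ\le p^*_{\min}$. If, in each iteration, the item set $X$ selected in Step 2 is $(L,p)$-minimal, i.e., $X$ is nonempty and $$L(p+\chi_Y)>L(p+\chi_X)\qquad\text{for every } Y\subsetneq X,$$ then the algorithm finds $p^*_{\min}$; that is, it terminates and the vector $p$ at termination equals $p^*_{\min}$. Moreover, the set $X$ selected in Step 2 is $(L,p)$-minimal if (i) $X$ is a minimal (with respect to inclusion) subset of $N$ satisfying $L(p+\chi_X)<L(p)$, or (ii) $X$ is the unique minimal (with respect to inclusion) minimizer of $L(p+\chi_X)-L(p)$ over the subsets $X$ of $N$.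
   Context: $u=(u(1),\dots,u(n))$ is a vector of positive integers, and $[\mathbf 0,u]_{\mathbb Z}=\{x\in\mathbb Z^n\mid 0\le x(i)\le u(i)\ (i\in N)\}$. For $X\subseteq N$, $\chi_X\in\{0,1\}^n$ is the characteristic vector of $X$. M$^\natural$-concavity. For $i\in N$, $\chi_i$ is the $i$th unit vector, and $\chi_0=\mathbf 0$. For $z\in\mathbb Z^n$, $\mathrm{supp}^+(z)=\{i\in N\mid z(i)>0\}$ and $\mathrm{supp}^-(z)=\{i\in N\mid z(i)<0\}$. A function $v:[\mathbf 0,u]_{\mathbb Z}\to\mathbb Z$ is M$^\natural$-concave if for all $x,y\in[\mathbf 0,u]_{\mathbb Z}$ and all $i\in\mathrm{supp}^+(x-y)$ there exists $k\in\mathrm{supp}^-(x-y)\cup\{0\}$ with $v(x)+v(y)\le v(x-\chi_i+\chi_k)+v(y+\chi_i-\chi_k)$. Under these assumptions $L$ has a unique minimal minimizer (componentwise order) over $\mathbb Z^n_+$, denoted $p^*_{\min}$. Algorithm Lyapunov Minimization. Step 0: Set $p:=p^\circ$, where $p^\circ\in\mathbb Z^n_+$ satisfies $p^\circ\le p^*_{\min}$. Step 1: If $L(p+\chi_X)\ge L(p)$ for all $X\subseteq N$, then stop. Step 2: Find a set $X\subseteq N$ such that $L(p+\chi_X)<L(p)$. Step 3: Set $p:=p+\chi_X$ and go to Step 1. *)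

(* Defs.v *)
From mathcomp Require Import all_boot all_order all_algebra.

Set Implicit Arguments.
Unset Strict Implicit.
Unset Printing Implicit Defensive.

Import Order.TTheory GRing.Theory Num.Theory.
Local Open Scope ring_scope.

Notation intvec n := {ffun 'I_n -> int}.

Definition vle n (x y : intvec n) : Prop := forall i, x i <= y i.

Definition nonneg n (x : intvec n) : Prop := vle 0 x.

Definition dot n (x y : intvec n) : int := \sum_(i < n) x i * y i.

Definition chi n (X : {set 'I_n}) : intvec n := [ffun i => (i \in X)%:R].

(* [unitv (Some i)] is chi_i and [unitv None] is chi_0 = 0. *)
Definition unitv n (k : option 'I_n) : intvec n :=
  if k is Some i then chi [set i] else 0.

Definition supp_pos n (z : intvec n) : {set 'I_n} := [set i | 0 < z i].
Definition supp_neg n (z : intvec n) : {set 'I_n} := [set i | z i < 0].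

Definition of_nat_vec n (u : {ffun 'I_n -> nat}) : intvec n :=
  [ffun i => (u i)%:Z].

Definition in_box n (u : {ffun 'I_n -> nat}) (x : intvec n) : Prop :=
  nonneg x /\ vle x (of_nat_vec u).

(* A valuation on the box is a function on all integer vectors of which only
   the values on the box matter.  In particular the two exchanged vectors below
   always lie in the box, because i is in supp_pos (x - y) and k is None or in
   supp_neg (x - y). *)
Definition Mnat_concave n (u : {ffun 'I_n -> nat}) (v : intvec n -> int) : Prop :=
  forall x y : intvec n, in_box u x -> in_box u y ->
  forall i : 'I_n, i \in supp_pos (x - y) ->
  exists k : option 'I_n,
    (if k is Some j then j \in supp_neg (x - y) else true) /\
    v x + v y <=
      v (x - unitv (Some i) + unitv k) + v (y + unitv (Some i) - unitv k).

Definition box_monotone n (u : {ffun 'I_n -> nat}) (v : intvec n -> int) : Prop :=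
  forall x y : intvec n, in_box u x -> in_box u y -> vle x y -> v x <= v y.

(* The box as a finite type, used to take maxima over it. *)
Notation box u := {dffun forall i, 'I_(u i).+1}.

Definition box_vec n (u : {ffun 'I_n -> nat}) (x : box u) : intvec n :=
  [ffun i => (x i : nat)%:Z].

Definition payoff n (v : intvec n -> int) (p x : intvec n) : int :=
  v x - dot p x.

(* The default value of the iterated maximum is the payoff of the zero vector,
   which belongs to the box, so this is the maximum over the box. *)
Definition indirect_utility n (u : {ffun 'I_n -> nat}) (v : intvec n -> int)
    (p : intvec n) : int :=
  \big[Num.max/payoff v p 0]_(x : box u) payoff v p (box_vec x).

Definition Lyapunov n m (u : {ffun 'I_n -> nat})
    (v : 'I_m -> intvec n -> int) (p : intvec n) : int :=
  \sum_(b < m) indirect_utility u (v b) p + dot p (of_nat_vec u).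

Section Algorithm.
Variables (n : nat) (L : intvec n -> int).
Implicit Types (p q : intvec n) (X Y : {set 'I_n}).

Definition minimizer p : Prop :=
  nonneg p /\ forall q, nonneg q -> L p <= L q.

Definition minimal_minimizer p : Prop :=
  minimizer p /\ forall q, minimizer q -> vle q p -> q = p.

Definition stops p : bool := [forall X : {set 'I_n}, L p <= L (p + chi X)].

Definition selectable p X : bool := L (p + chi X) < L p.

(* [ps k] and [Xs k] are the vector p and the set X selected in iteration k;
   once the algorithm has stopped, the vector stays constant and the sets [Xs k]
   are meaningless.  Since the choice in Step 2 is free and may depend on the
   history, the possible runs are exactly such pairs of sequences. *)
Definition execution p0 (ps : nat -> intvec n) (Xs : nat -> {set 'I_n}) : Prop :=
  ps 0%N = p0 /\
  forall k : nat,
    if stops (ps k) then ps k.+1 = ps k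
    else selectable (ps k) (Xs k) /\ ps k.+1 = ps k + chi (Xs k).

Definition terminates_with (ps : nat -> intvec n) q : Prop :=
  exists T : nat,
    [/\ forall k : nat, (k < T)%N -> ~~ stops (ps k), stops (ps T) & ps T = q].

Definition Lp_minimal p X : Prop :=
  X != set0 /\ forall Y, Y \proper X -> L (p + chi X) < L (p + chi Y).

Definition set_minimizer p X : bool :=
  [forall Y : {set 'I_n}, L (p + chi X) - L p <= L (p + chi Y) - L p].

End Algorithm.

(* Main.v *)
Require Import Defs.
From mathcomp Require Import all_boot all_order all_algebra.
From mathcomp Require Import zify.

Set Implicit Arguments.
Unset Strict Implicit.
Unset Printing Implicit Defensive.

Import Order.TTheory GRing.Theory Num.Theory.
Local Open Scope ring_scope.

(** Everything rests on one inequality for the Lyapunov function L, a form of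
    L-natural convexity ([Lyapunov_submodular]):

      L r + L (s + chi A) <= L (r + chi A) + L s

    whenever on A the difference s - r is nonpositive and attains its minimum
    over all items.  It says that a price rise on A costs a bidder at least as
    much utility at s as at r: relative to r, prices at s are obtained by raising the
    prices of the items outside A and then lowering all prices by one common
    amount, and both changes favour the items of A.  Since the
    linear term of L contributes equally to both sides, it suffices to treat a
    single bidder, and adding the items of A one by one reduces A to a single
    item i.  There the exchange property and the integrality of valuations
    show that the least demand for i at r is at most the greatest demand for i
    at s + chi_i ([demand_monotone]), and evaluating these two bundles at
    r + chi_i and s gives the inequality.

    Let p <= pmin.  Two instances of the inequality settle the algorithm.

    - The algorithm does not overshoot ([Lp_minimal_step]).  Let X' be the set
      of the i in X with p i < pmin i.  With r = p + chi X', s = pmin and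
      A = X \ X', and since L pmin <= L (pmin + chi A), one gets
      L (p + chi X') <= L (p + chi X); minimality of X forces X' = X.

    - The algorithm does not stop early ([stops_minimal_minimizer]).  If
      p <> pmin, let A be the set of items where pmin - p is largest.  With
      r = pmin - chi A and s = p, the stopping rule L p <= L (p + chi A) gives
      L (pmin - chi A) <= L pmin, so pmin is not a minimal minimizer.

    Each step raises some price and prices never exceed pmin, so a run is finite.
    Both criteria for the choice of X are immediate: a set Y strictly inside X
    violating (L,p)-minimality satisfies L (p + chi Y) <= L (p + chi X), hence
    competes with X for inclusion-minimality. *)

(** * Characteristic vectors and the scalar product *)

Lemma chiE n (X : {set 'I_n}) i : chi X i = if i \in X then 1 else 0.
Proof. by rewrite ffunE; case: ifP. Qed.

Lemma chi_ge0 n (X : {set 'I_n}) i : 0 <= chi X i.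
Proof. by rewrite chiE; case: ifP. Qed.

Lemma unitvE n (k : option 'I_n) j : unitv k j = if k == Some j then 1 else 0.
Proof.
case: k => [i|] /=; last by rewrite ffunE.
by rewrite chiE inE (inj_eq Some_inj) eq_sym.
Qed.

Lemma chi0 n : chi (set0 : {set 'I_n}) = 0.
Proof. by apply/ffunP=> i; rewrite !ffunE inE. Qed.

Lemma chiD1 n (A : {set 'I_n}) i :
  i \in A -> chi A = chi (A :\ i) + unitv (Some i).
Proof.
move=> iA; apply/ffunP=> j; rewrite [RHS]ffunE unitvE !chiE !inE.
rewrite (inj_eq Some_inj) eq_sym.
by have [<-|ij] := eqVneq i j; rewrite /= ?iA ?add0r ?addr0.
Qed.

Lemma dotDl n (p q x : intvec n) : dot (p + q) x = dot p x + dot q x.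
Proof. by rewrite -big_split; apply: eq_bigr => i _; rewrite ffunE mulrDl. Qed.

Lemma dotDr n (p x y : intvec n) : dot p (x + y) = dot p x + dot p y.
Proof. by rewrite -big_split; apply: eq_bigr => i _; rewrite ffunE mulrDr. Qed.

Lemma dotNr n (p x : intvec n) : dot p (- x) = - dot p x.
Proof. by rewrite -sumrN; apply: eq_bigr => i _; rewrite ffunE mulrN. Qed.

Lemma dot_unitv n (p : intvec n) k :
  dot p (unitv k) = if k is Some i then p i else 0.
Proof.
case: k => [i|]; last by rewrite /dot big1 // => i _; rewrite ffunE mulr0.
rewrite /dot (bigD1 i) //= big1 ?addr0 => [|j ji].
  by rewrite chiE set11 mulr1.
by rewrite chiE inE (negPf ji) mulr0.
Qed.

Lemma dot_unitvl n i (x : intvec n) : dot (unitv (Some i)) x = x i.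
Proof.
by rewrite -(dot_unitv x (Some i)); apply: eq_bigr => j _; rewrite mulrC.
Qed.

Lemma nonneg_add_chi n (p : intvec n) X : nonneg p -> nonneg (p + chi X).
Proof. by move=> p0 i; rewrite [leRHS]ffunE ler_wpDr ?chi_ge0. Qed.

(** * Demand and indirect utility of one bidder *)

Section IndirectUtility.
Variables (n : nat) (u : {ffun 'I_n -> nat}) (v : intvec n -> int).
Implicit Types (p r s x y : intvec n) (i j : 'I_n) (k : option 'I_n).
Local Notation V := (indirect_utility u v).

Lemma in_boxE x : in_box u x <-> forall i, 0 <= x i <= (u i)%:Z.
Proof.
split=> [[x0 xu] i|xb]; last first.
  by split=> i; have := xb i; rewrite !ffunE => /andP[].
by have := x0 i; have := xu i; rewrite !ffunE => -> ->.
Qed.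

Lemma in_box_box_vec (z : box u) : in_box u (box_vec z).
Proof. by apply/in_boxE => i; rewrite ffunE /= lez_nat -ltnS ltn_ord. Qed.

Lemma box_vec_surj x : in_box u x -> exists z : box u, box_vec z = x.
Proof.
move=> /in_boxE xb; exists [ffun i => inord `|x i|%N].
apply/ffunP => i; rewrite !ffunE inordK; move: (xb i);
  by move: (x i) (u i) => a b; lia.
Qed.

Lemma payoff_le_indirect_utility p x : in_box u x -> payoff v p x <= V p.
Proof. by move=> /box_vec_surj[z <-]; apply: le_bigmax. Qed.

Definition demanded p (z : box u) : bool := payoff v p (box_vec z) == V p.

Lemma demanded_exists p : exists z, demanded p z.
Proof.
have [z0 z00] : exists z : box u, box_vec z = 0.
  by apply: box_vec_surj; apply/in_boxE => i; rewrite ffunE; lia.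
case: (arg_maxP (fun z : box u => payoff v p (box_vec z)) (isT : predT z0)).
move=> z _ zmax; exists z; rewrite /demanded eq_le payoff_le_indirect_utility.
  by apply: bigmax_le => [|z' _]; [rewrite -z00|]; apply: zmax.
exact: in_box_box_vec.
Qed.

Lemma exchange_in_box x y i k :
    in_box u x -> in_box u y -> y i < x i ->
    (if k is Some j then x j < y j else true) ->
  in_box u (x - unitv (Some i) + unitv k) /\
  in_box u (y + unitv (Some i) - unitv k).
Proof.
move=> /in_boxE xb /in_boxE yb yxi xyk.
split; apply/in_boxE => j; rewrite !(unitvE, ffunE) (inj_eq Some_inj);
  move: (xb i) (yb i) (xb j) (yb j) => xbi ybi xbj ybj;
  case: k xyk => [l xyl|_] /=; rewrite ?(inj_eq Some_inj);
  (have [eij|nij] := eqVneq i j; [subst j|]);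
  try (have [elj|nlj] := eqVneq l _; [subst l|]); lia.
Qed.

Hypothesis v_exc : Mnat_concave u v.

(** If x demanded more of i than y, the exchange property would move one unit
    of i from x to y, possibly against a unit of another item.  By the
    conditions on s - r, that exchange lowers the total payoff of the pair by at
    most 1, the cost of one more unit of i at the raised price.  Both new
    bundles are suboptimal by the extremality of x and y, so by integrality each
    loses at least 1: a contradiction. *)
Lemma demand_monotone r s i (x y : box u) :
    s i <= r i -> (forall j, s i - r i <= s j - r j) ->
    demanded r x -> (forall z, demanded r z -> (x i <= z i)%N) ->
    demanded (s + unitv (Some i)) y ->
    (forall z, demanded (s + unitv (Some i)) z -> (z i <= y i)%N) ->
  (x i <= y i)%N.
Proof.
move=> sr_i sr_min /eqP Dx x_min /eqP Dy y_max.
rewrite leqNgt; apply/negP => yx_i.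
have Bx := in_box_box_vec x; have By := in_box_box_vec y.
have yx_i' : box_vec y i < box_vec x i by rewrite !ffunE.
have [|k [k_neg vk]] := v_exc Bx By (i := i).
  by rewrite inE !ffunE subr_gt0.
have {}k_neg : is_true (if k is Some j then box_vec x j < box_vec y j else true).
  by case: k k_neg {vk} => // j; rewrite inE !ffunE subr_lt0.
have [Bx' By'] := exchange_in_box Bx By yx_i' k_neg.
have ik : k != Some i.
  by apply/eqP => ki; move: k_neg; rewrite ki => /lt_trans/(_ yx_i'); rewrite ltxx.
have := payoff_le_indirect_utility r Bx'.
have := payoff_le_indirect_utility (s + unitv (Some i)) By'.
have [x' Ex] := box_vec_surj Bx'; have [y' Ey] := box_vec_surj By'.
(* x has a unit of i to give, which the unit k <> i does not put back. *)
have x'i : x' i = (x i).-1 :> nat.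
  move/ffunP/(_ i): Ex; rewrite !(unitvE, ffunE) eqxx (negPf ik).
  by move: yx_i; lia.
have y'i : y' i = (y i).+1 :> nat.
  by move/ffunP/(_ i): Ey; rewrite !(unitvE, ffunE) eqxx (negPf ik); lia.
have nDx' : payoff v r (box_vec x') <> V r.
  by move/eqP/x_min; move: yx_i; rewrite x'i; lia.
have nDy' : payoff v (s + unitv (Some i)) (box_vec y') <> V (s + unitv (Some i)).
  by move/eqP/y_max; rewrite y'i; lia.
move: nDx' nDy'; rewrite Ex Ey -Dx -Dy /payoff !dotDl !dot_unitvl.
rewrite !(dotDr, dotNr) !dot_unitv !(unitvE, ffunE) eqxx (negPf ik).
case: k vk {k_neg Bx' By' ik Ex Ey} => [j|] vk; last by lia.
by have := sr_min j; lia.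
Qed.

(** With x and y the extremal bundles of [demand_monotone], x is still available
    at r + chi_i, where it costs x i more, and y at s, where it costs y i less;
    so x i <= y i makes the sum of the two utilities at least as large. *)
Lemma indirect_utility_submodular1 r s i :
    s i <= r i -> (forall j, s i - r i <= s j - r j) ->
  V r + V (s + unitv (Some i)) <= V (r + unitv (Some i)) + V s.
Proof.
move=> sr_i sr_min.
have [x0 Dx0] := demanded_exists r.
have [y0 Dy0] := demanded_exists (s + unitv (Some i)).
case: (arg_minnP (fun z : box u => z i : nat) Dx0) => x Dx x_min.
case: (arg_maxnP (fun z : box u => z i : nat) Dy0) => y Dy y_max.
have xy := demand_monotone sr_i sr_min Dx x_min Dy y_max.
have := payoff_le_indirect_utility (r + unitv (Some i)) (in_box_box_vec x).
have := payoff_le_indirect_utility s (in_box_box_vec y).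
rewrite -(eqP Dx) -(eqP Dy) /payoff !dotDl !dot_unitvl !ffunE.
by move: xy; lia.
Qed.

End IndirectUtility.

(** * The Lyapunov function and the runs of the algorithm *)

Section Lyapunov.
Variables (n m : nat) (u : {ffun 'I_n -> nat}) (v : 'I_m -> intvec n -> int).
Hypothesis v_exc : forall b, Mnat_concave u (v b).
Local Notation L := (Lyapunov u v).
Implicit Types (p q r s : intvec n) (A X : {set 'I_n}) (i j : 'I_n) (k : nat).

(** Adding a set to both r and s leaves s - r unchanged, so the items of A can be
    added one at a time, each under the same hypotheses.  When s - r vanishes
    on A this is submodularity of L; allowing s - r to be negative on A gives in
    addition its submodularity along the all-ones direction. *)
Lemma Lyapunov_submodular r s A :
    (forall i, i \in A -> s i <= r i) ->
    (forall i j, i \in A -> s i - r i <= s j - r j) ->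
  L r + L (s + chi A) <= L (r + chi A) + L s.
Proof.
have [c] := ubnP #|A|; elim: c r s A => // c IH r s A Ac sr sr_min.
have [->|/set0Pn[i iA]] := eqVneq A set0; first by rewrite chi0 !addr0.
have AiA j : j \in A :\ i -> j \in A by case/setD1P.
have {}IH : L r + L (s + chi (A :\ i)) <= L (r + chi (A :\ i)) + L s.
  apply: IH => [|j /AiA/sr //|j k /AiA jA]; last exact: sr_min.
  by move: Ac; rewrite (cardsD1 i) iA.
suff : L (r + chi (A :\ i)) + L (s + chi A) <=
       L (r + chi A) + L (s + chi (A :\ i)) by move: IH; lia.
rewrite (chiD1 iA) (addrA r) (addrA s) /Lyapunov !(dotDl _ (unitv _)).
set r' := r + _; set s' := s + _.
have /ler_sum H : forall b : 'I_m, true ->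
    indirect_utility u (v b) r' + indirect_utility u (v b) (s' + unitv (Some i))
    <= indirect_utility u (v b) (r' + unitv (Some i)) + indirect_utility u (v b) s'.
  move=> b _; apply: indirect_utility_submodular1 => // [|k].
    by rewrite !ffunE lerD2r sr.
  by rewrite !ffunE !opprD !(addrACA _ _ (- _)) !subrr !addr0 sr_min.
(* The linear terms cancel. *)
have E (a b c' d e f g : int) :
    a + b <= c' + d -> a + e + (b + (f + g)) <= c' + (e + g) + (d + f) by lia.
by apply: E; rewrite -!big_split; apply: H.
Qed.

(** Raising the prices in X that have already reached pmin would not pay: by
    submodularity against pmin, dropping these items from X does not increase L,
    which minimality of X excludes unless there are none. *)
Lemma Lp_minimal_step pmin p X :
    minimizer L pmin -> vle p pmin -> Lp_minimal L p X ->
  vle (p + chi X) pmin.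
Proof.
move=> [pmin0 pmin_le] ppmin [_ Xmin].
pose A := [set i | p i < pmin i].
have [/subsetP XA | XnA] := boolP (X \subset A).
  move=> i; rewrite ffunE chiE; case: (boolP (i \in X)) => [/XA|_].
    by rewrite inE -lezD1.
  by rewrite addr0.
have XAX : X :&: A \proper X.
  by rewrite properEneq subsetIl andbT; apply: contra XnA => /eqP/setIidPl.
have := @Lyapunov_submodular (p + chi (X :&: A)) pmin (X :\: A).
have -> : p + chi (X :&: A) + chi (X :\: A) = p + chi X.
  rewrite -addrA; congr (_ + _); apply/ffunP => i; rewrite ffunE !chiE !inE.
  by case: (i \in X) (p i < pmin i) => [] [].
have := pmin_le _ (nonneg_add_chi (X :\: A) pmin0).
move: (Xmin _ XAX) => lt1 le2 H.
suff : L (p + chi (X :&: A)) + L (pmin + chi (X :\: A)) <= L (p + chi X) + L pmin.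
  by move: lt1 le2; lia.
apply: H => [i|i k]; rewrite in_setD inE -leNgt => /andP[pmin_i _].
  by rewrite ffunE (le_trans pmin_i) // lerDl chi_ge0.
rewrite !(chiE, ffunE, inE) (ltNge (p i)) pmin_i andbF.
by have := ppmin k; case: (k \in X); case: ltP => /=; lia.
Qed.

(** On the items where pmin - p is largest, p - r is smallest for
    r = pmin - chi A; this is where submodularity along the all-ones direction is
    used, since p - r may be negative there. *)
Lemma stops_minimal_minimizer pmin p :
    minimal_minimizer L pmin -> nonneg p -> vle p pmin -> stops L p ->
  p = pmin.
Proof.
move=> [[pmin0 pmin_le] pmin_min] p0 ppmin /forallP stop_p.
apply/ffunP => i0; apply/eqP; rewrite eq_le ppmin /= leNgt.
apply/negP => pi0.
case: (arg_maxP (fun i => pmin i - p i) (isT : predT i0)) => j _ j_max.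
pose A := [set i | pmin i - p i == pmin j - p j].
have j_gt0 : p j < pmin j by have := j_max i0 isT; rewrite /=; lia.
have A_max i : i \notin A -> pmin i - p i < pmin j - p j.
  by rewrite inE => ni; have := j_max i isT; rewrite /= le_eqVlt (negPf ni).
have AE i : i \in A -> pmin i - p i = pmin j - p j by rewrite inE => /eqP.
pose r := pmin - chi A.
have pr : vle p r.
  move=> i; rewrite !(chiE, ffunE).
  by case: (boolP (i \in A)) => [/AE|_]; have := ppmin i; rewrite /=; lia.
have r0 : nonneg r by move=> i; exact: le_trans (p0 i) (pr i).
have Lr : L r <= L pmin.
  have : L r + L (p + chi A) <= L (r + chi A) + L p.
    apply: Lyapunov_submodular => [i _|i k iA]; first exact: pr.
    rewrite !(chiE, ffunE) iA; have := AE _ iA.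
    by case: (boolP (k \in A)) => [/AE|/A_max] /=; lia.
  by rewrite subrK; have := stop_p A; lia.
have : r = pmin.
  apply: pmin_min => [|i]; last by rewrite !(chiE, ffunE) gerBl; case: ifP.
  by split=> // q q0; apply: le_trans Lr (pmin_le q q0).
by move/ffunP/(_ j); rewrite !(chiE, ffunE) inE eqxx; lia.
Qed.

Lemma minimal_run_terminates pmin p0 ps Xs :
    minimal_minimizer L pmin -> nonneg p0 -> vle p0 pmin ->
    execution L p0 ps Xs ->
    (forall k, ~~ stops L (ps k) -> Lp_minimal L (ps k) (Xs k)) ->
  terminates_with L ps pmin.
Proof.
move=> hpmin hp0 p0pmin [ps0 step] Xs_min.
have inv k : nonneg (ps k) /\ vle (ps k) pmin.
  elim: k => [|k [IH0 IHle]]; first by rewrite ps0.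
  move: (step k) (Xs_min k); case: (stops L (ps k)) => [-> _ //|[_ ->] /(_ isT) XkM].
  split; last exact: (Lp_minimal_step hpmin.1 IHle XkM).
  exact: nonneg_add_chi.
have sum_le k : \sum_i ps k i <= \sum_i pmin i.
  by apply: ler_sum => i _; apply: (inv k).2.
(* After B steps the total price would exceed that of pmin. *)
pose B := (absz (\sum_i pmin i)).+1.
have [T stopT] : exists T, stops L (ps T).
  have [/existsP[k ?]|] := boolP [exists k : 'I_(B), stops L (ps k)].
    by exists k.
  rewrite negb_exists => /forallP nostop.
  have grow k : (k <= B)%N -> k%:Z <= \sum_i ps k i.
    elim: k => [_|k IH kT].
      by apply: sumr_ge0 => i _; have := (inv 0).1 i; rewrite ffunE.
    have ns := nostop (Ordinal kT).
    move: (step k) (Xs_min k ns); rewrite (negPf ns) => -[_ ->] [/set0Pn[j jX] _].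
    have : 1 <= \sum_i chi (Xs k) i.
      by rewrite (bigD1 j) //= chiE jX lerDl sumr_ge0 // => i _; rewrite chi_ge0.
    under [X in _ -> _ <= X]eq_bigr do rewrite ffunE.
    by rewrite big_split -addn1 PoszD; apply: lerD (IH (ltnW kT)).
  by have := grow _ (leqnn _); have := sum_le B; rewrite /B; lia.
have exT : exists T, stops L (ps T) by exists T.
case: (ex_minnP exT) => {stopT}T stopT Tmin; exists T; split=> //.
  by move=> k kT; apply/negP => /Tmin; rewrite leqNgt kT.
exact: stops_minimal_minimizer hpmin (inv T).1 (inv T).2 stopT.
Qed.

End Lyapunov.

(** * Selection rules giving minimal sets *)

Section Selection.
Variables (n : nat) (L : intvec n -> int).
Implicit Types (p : intvec n) (X : {set 'I_n}).

Lemma selectable_neq0 p X : selectable L p X -> X != set0.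
Proof.
by rewrite /selectable => sX; apply: contraTneq sX => ->; rewrite chi0 addr0 ltxx.
Qed.

Lemma minset_selectable_Lp_minimal p X :
  minset (selectable L p) X -> Lp_minimal L p X.
Proof.
move=> /minsetP[sX Xmin]; split=> [|Y YX]; first exact: selectable_neq0 sX.
rewrite (lt_le_trans sX) // leNgt; apply/negP => /Xmin/(_ (proper_sub YX)) YeqX.
by move: YX; rewrite YeqX properxx.
Qed.

Lemma minset_minimizer_Lp_minimal p X :
    selectable L p X -> minset (set_minimizer L p) X -> Lp_minimal L p X.
Proof.
move=> sX /minsetP[/forallP X_le Xmin]; split=> [|Y YX].
  exact: selectable_neq0 sX.
rewrite ltNge; apply/negP => YleX.
suff /Xmin/(_ (proper_sub YX)) YeqX : set_minimizer L p Y.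
  by move: YX; rewrite YeqX properxx.
by apply/forallP => Z; apply: le_trans (X_le Z); rewrite lerD2r.
Qed.

End Selection.

Theorem theorem6p2 (n m : nat) (u : {ffun 'I_n -> nat})
    (v : 'I_m -> intvec n -> int) (pmin : intvec n)
    (hu : forall i : 'I_n, (0 < u i)%N)
    (hM : forall b : 'I_m, Mnat_concave u (v b))
    (hmono : forall b : 'I_m, box_monotone u (v b))
    (hv0 : forall b : 'I_m, v b 0 = 0)
    (hpmin : unique (minimal_minimizer (Lyapunov u v)) pmin) :
  (forall (p0 : intvec n) (ps : nat -> intvec n) (Xs : nat -> {set 'I_n}),
     nonneg p0 -> vle p0 pmin ->
     execution (Lyapunov u v) p0 ps Xs ->
     (forall k : nat, ~~ stops (Lyapunov u v) (ps k) ->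
        Lp_minimal (Lyapunov u v) (ps k) (Xs k)) ->
     terminates_with (Lyapunov u v) ps pmin)
  /\
  (forall (p : intvec n) (X : {set 'I_n}),
     nonneg p -> selectable (Lyapunov u v) p X ->
     minset (selectable (Lyapunov u v) p) X \/
     unique (fun Y : {set 'I_n} => minset (set_minimizer (Lyapunov u v) p) Y) X ->
     Lp_minimal (Lyapunov u v) p X).
Proof.
split=> [p0 ps Xs hp0 p0pmin run Xs_min|p X _ sX [Xmin|[Xmin _]]].
- exact: minimal_run_terminates hpmin.1 hp0 p0pmin run Xs_min.
- exact: minset_selectable_Lp_minimal.
- exact: minset_minimizer_Lp_minimal.
Qed.
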